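(* Let $a,b,c,d$ be positive integers such that $a$ is the smallest, i.e. $a=\min(a,b,c,d)$. Suppose there exists a pair of integers $x\le y$ such that (1) $a\le x\le\min(c,d)$, (2) $x+y\le c+d$, (3) $xy\ge ab$, (4) $a$ divides either $x$ or $y$. Then $$\begin{bmatrix}c+d\\ c\end{bmatrix}-\begin{bmatrix}a+b\\ a\end{bmatrix}\in\mathbb{N}_0[q].$$
   Context: $\mathbb{N}_0$ is the set of non-negative integers. $\begin{bmatrix}n\\k\end{bmatrix}=\frac{[n][n-1]\cdots[n-k+1]}{[k][k-1]\cdots[1]}$ is the Gaussian ($q$-)binomial coefficient, a polynomial in $q$, where $[n]=1+q+\cdots+q^{n-1}$. *)

(* Defs.v *)
From mathcomp Require Import all_boot all_order all_algebra.
From mathcomp Require Import ring.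

Set Implicit Arguments.
Unset Strict Implicit.
Unset Printing Implicit Defensive.

Import Order.TTheory GRing.Theory Num.Theory.
Local Open Scope ring_scope.

Definition qint (n : nat) : {poly int} := \sum_(i < n) 'X^i.

Definition qfalling (n k : nat) : {poly int} := \prod_(i < k) qint (n - i)%N.

(* The denominator [k][k-1]...[1] is [qfalling k k], which is monic, so [%/] is
   Euclidean division in {poly int}; by [gauss_binomK] the division is exact.
   For k > n the numerator contains the factor [0] = 0, hence the value is 0. *)
Definition gauss_binom (n k : nat) : {poly int} := qfalling n k %/ qfalling k k.

Lemma qint_monic n : (0 < n)%N -> qint n \is monic.
Proof.
case: n => // n _.
have -> : qint n.+1 = \poly_(i < n.+1) 1.
  by rewrite poly_def; apply: eq_bigr => i _; rewrite scale1r.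
by rewrite monicE lead_coef_poly // oner_eq0.
Qed.

Lemma qfalling_monic k : qfalling k k \is monic.
Proof. by apply: monic_prod => i _; apply: qint_monic; rewrite subn_gt0. Qed.

Lemma qintD m n : qint (m + n)%N = qint m + 'X^m * qint n.
Proof.
rewrite /qint big_split_ord mulr_sumr /=; congr (_ + _).
by apply: eq_bigr => i _; rewrite exprD.
Qed.

Lemma qfallingSl n k : qfalling n.+1 k.+1 = qint n.+1 * qfalling n k.
Proof. by rewrite /qfalling big_ord_recl subn0. Qed.

Lemma qfallingSr n k : qfalling n k.+1 = qfalling n k * qint (n - k).
Proof. by rewrite /qfalling big_ord_recr. Qed.

Lemma qfalling_small n k : (n < k)%N -> qfalling n k = 0.
Proof.
move=> ltnk; rewrite /qfalling (bigD1 (Ordinal ltnk)) //= subnn.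
by rewrite /qint big_ord0 mul0r.
Qed.

Lemma qfalling_dvd n k : exists g, qfalling n k = g * qfalling k k.
Proof.
elim: n k => [|n IHn] [|k]; try by exists 1; rewrite mul1r /qfalling !big_ord0.
  by exists 0; rewrite qfalling_small // mul0r.
have [lenk | ltnk] := leqP k n; last by exists 0; rewrite qfalling_small ?mul0r.
have [g0 e0] := IHn k; have [g1 e1] := IHn k.+1.
exists (g0 + 'X^(k.+1) * g1).
have -> : qfalling n.+1 k.+1
          = qint k.+1 * qfalling n k + 'X^(k.+1) * qfalling n k.+1.
  rewrite qfallingSl qfallingSr -{1}(subnKC lenk) -addSn qintD; ring.
rewrite e0 e1 qfallingSl; ring.
Qed.

Lemma gauss_binomK n k : gauss_binom n k * qfalling k k = qfalling n k.
Proof.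
have [g e] := qfalling_dvd n k.
by rewrite /gauss_binom e Pdiv.IdomainMonic.mulpK ?qfalling_monic.
Qed.

(* Main.v *)
Require Import Defs.
From mathcomp Require Import all_boot all_order all_algebra.
From mathcomp Require Import zify ring.

(** Write P <= Q for polynomials when Q - P has non-negative coefficients.  The
    theorem is obtained from two families of inequalities between Gaussian
    binomials.

    First, [n, k] is monotone: it grows with n, and it grows with k as long as
    k <= n / 2 (gauss_binom_mono_n, gauss_binom_mono_k).  As x <= min(c, d) and
    x + y <= c + d, this gives [x+y, x] <= [c+d, c].

    Second, the divisibility case: if 0 < k and a <= y then
    [a + ky, a] <= [y + ka, y] (gauss_binom_swap).  If x = ka then b <= ky by
    xy >= ab, hence [a+b, a] <= [a+ky, a] <= [y+x, y]; the case y = ka is the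
    same with x in the place of y, since a <= x too.

    For the second family, [a + n, a] counts words with n letters B and a
    letters X by the number of pairs (B before X).  Read a word as a walk with
    steps B = +1 and X = -k.  The left side counts walks from 0 to kd, the right
    side walks from 0 to -kd, with d = y - a.  Since the walk never jumps
    upwards, a walk w that ends at kd > 0 has a last visit to level k(d-1), and
    after it the walk starts with a run of k letters B:  w = u B^k t, where t
    is a closed walk that stays above -k.  Recursively send w to t X f(u).
    Both words have the same number of pairs (B before X): the k letters B meet
    each X of t, while X meets each B of t, and t has k times as many B as X;
    in the same way u meets t as t meets f(u), since u has k times as many B as
    f(u) has X.  And t is recovered from t X f(u) as the part before the step
    that leads to level -k for the first time, so the map is injective. *)

Import Order.TTheory GRing.Theory Num.Theory.
Local Open Scope ring_scope.

(** * Coefficientwise order on integer polynomials *)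

Definition coef_ge0 (P : {poly int}) : Prop := forall i, 0 <= P`_i.

Definition coef_le (P Q : {poly int}) : Prop := coef_ge0 (Q - P).

Lemma coef_ge0_0 : coef_ge0 0.
Proof. by move=> i; rewrite coef0. Qed.

Lemma coef_ge0_Xn n : coef_ge0 'X^n.
Proof. by move=> i; rewrite coefXn; case: eqP. Qed.

Lemma coef_ge0_X : coef_ge0 'X.
Proof. exact: (coef_ge0_Xn 1). Qed.

Lemma coef_ge0_1 : coef_ge0 1.
Proof. exact: (coef_ge0_Xn 0). Qed.

Lemma coef_ge0D P Q : coef_ge0 P -> coef_ge0 Q -> coef_ge0 (P + Q).
Proof. by move=> hP hQ i; rewrite coefD addr_ge0. Qed.

Lemma coef_ge0M P Q : coef_ge0 P -> coef_ge0 Q -> coef_ge0 (P * Q).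
Proof.
by move=> hP hQ i; rewrite coefM sumr_ge0 // => j _; rewrite mulr_ge0.
Qed.

Lemma coef_ge0_polyOver P : coef_ge0 P -> P \is a polyOver Num.nat.
Proof. by move=> hP; apply/polyOverP => i; rewrite Znat_def hP. Qed.

Lemma coef_le_refl P : coef_le P P.
Proof. by rewrite /coef_le subrr; apply: coef_ge0_0. Qed.

Lemma coef_le_trans Q P R : coef_le P Q -> coef_le Q R -> coef_le P R.
Proof.
rewrite /coef_le => hPQ hQR; have -> : R - P = (R - Q) + (Q - P) by ring.
exact: coef_ge0D.
Qed.

(** * Pascal rules and monotonicity of Gaussian binomials *)

Lemma gauss_binom_n0 n : gauss_binom n 0 = 1.
Proof.
by have := gauss_binomK n 0; rewrite /qfalling !big_ord0 mulr1.
Qed.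

Lemma gauss_binom_nn n : gauss_binom n n = 1.
Proof.
apply: (mulIf (monic_neq0 (qfalling_monic n))).
by rewrite gauss_binomK mul1r.
Qed.

Lemma gauss_binom_small n k : (n < k)%N -> gauss_binom n k = 0.
Proof.
move=> ltnk; apply: (mulIf (monic_neq0 (qfalling_monic k))).
by rewrite gauss_binomK mul0r qfalling_small.
Qed.

Lemma gauss_binom_pascal n k :
  gauss_binom n.+1 k.+1 = gauss_binom n k + 'X^(k.+1) * gauss_binom n k.+1.
Proof.
have [lenk | ltnk] := leqP k n; last first.
  by rewrite !gauss_binom_small ?mulr0 ?addr0 // ltnW.
apply: (mulIf (monic_neq0 (qfalling_monic k.+1))).
rewrite mulrDl -mulrA !gauss_binomK (qfallingSl k k) mulrCA gauss_binomK.
by rewrite qfallingSl qfallingSr -{1}(subnKC lenk) -addSn qintD; ring.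
Qed.

Lemma gauss_binom_pascal' n k : (k <= n)%N ->
  gauss_binom n.+1 k.+1 = gauss_binom n k.+1 + 'X^(n - k) * gauss_binom n k.
Proof.
move=> lekn; apply: (mulIf (monic_neq0 (qfalling_monic k.+1))).
rewrite mulrDl -mulrA !gauss_binomK (qfallingSl k k).
rewrite (mulrCA (gauss_binom n k)) gauss_binomK qfallingSl qfallingSr.
by rewrite -{1}(subnK lekn) -addnS qintD; ring.
Qed.

Lemma gauss_binom_sym m n : gauss_binom (m + n) m = gauss_binom (m + n) n.
Proof.
elim: m n => [|m IHm] n; first by rewrite gauss_binom_n0 gauss_binom_nn.
elim: n => [|n IHn]; first by rewrite addn0 gauss_binom_n0 gauss_binom_nn.
rewrite addnS gauss_binom_pascal gauss_binom_pascal'; last lia.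
rewrite IHn addSnnS IHm; congr (_ + 'X^_ * _); lia.
Qed.

Lemma gauss_binom_ge0 n k : coef_ge0 (gauss_binom n k).
Proof.
elim: n k => [|n IHn] [|k].
- by rewrite gauss_binom_n0; apply: coef_ge0_1.
- by rewrite gauss_binom_small //; apply: coef_ge0_0.
- by rewrite gauss_binom_n0; apply: coef_ge0_1.
rewrite gauss_binom_pascal; apply: coef_ge0D => //.
by apply: coef_ge0M (IHn _); apply: coef_ge0_Xn.
Qed.

Lemma gauss_binom_mono_n m n k : (m <= n)%N ->
  coef_le (gauss_binom m k) (gauss_binom n k).
Proof.
move=> lemn; rewrite -(subnKC lemn); elim: (n - m)%N => [|j IHj].
  by rewrite addn0; apply: coef_le_refl.
apply: coef_le_trans IHj _; rewrite addnS.
case: k => [|k]; first by rewrite !gauss_binom_n0; apply: coef_le_refl.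
have [lekn | ltnk] := leqP k (m + j); last first.
  by rewrite !gauss_binom_small //; [apply: coef_le_refl | apply: ltnW].
rewrite /coef_le gauss_binom_pascal' // addrAC subrr add0r.
by apply: coef_ge0M (gauss_binom_ge0 _ _); apply: coef_ge0_Xn.
Qed.

(** Induction on n for both kinds of differences at once, since Pascal's rules
    express each kind through the two kinds one step below:
    [n+1, k+1] - [n+1, k] is [n, k+1] - [n, k] plus q^(n-k) times
    [n, k] - q [n, k-1], and [n+1, k+1] - q [n+1, k] is [n, k] - q [n, k-1] plus
    q^(k+1) times [n, k+1] - [n, k]. *)
Lemma gauss_binom_rise n :
     (forall k, (k.*2.+1 <= n)%N ->
        coef_le (gauss_binom n k) (gauss_binom n k.+1))
  /\ (forall k, (k.+1.*2 <= n)%N ->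
        coef_le ('X * gauss_binom n k) (gauss_binom n k.+1)).
Proof.
elim: n => [|n [IH1 IH2]]; first by split.
split=> k lek.
  have [lek' | ltk] := leqP k.*2.+1 n; last first.
    (* Here n = 2k: the two binomials sit symmetrically around the middle. *)
    have -> : n.+1 = (k + k.+1)%N by lia.
    by rewrite gauss_binom_sym; apply: coef_le_refl.
  case: k lek lek' => [|k] lek lek'.
    rewrite /coef_le gauss_binom_pascal' // !gauss_binom_n0 mulr1 addrAC.
    apply: coef_ge0D (coef_ge0_Xn _).
    by have := IH1 0%N lek'; rewrite /coef_le gauss_binom_n0.
  have le2 : (k.+1.*2 <= n)%N by lia.
  have := IH1 _ lek'; have := IH2 _ le2.
  rewrite /coef_le (gauss_binom_pascal' n k.+1) ?(gauss_binom_pascal' n k);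
    try lia.
  have -> : (n - k = (n - k.+1).+1)%N by lia.
  rewrite exprS.
  set A := gauss_binom n k.+2; set B := gauss_binom n k.+1.
  set C := gauss_binom n k; set Y := 'X^_ => h2 h1.
  have -> : A + Y * B - (B + 'X * Y * C) = (A - B) + Y * (B - 'X * C) by ring.
  by apply: coef_ge0D h1 _; apply: coef_ge0M h2; apply: coef_ge0_Xn.
case: k lek => [|k] lek.
  have h1 : coef_le (gauss_binom n 0) (gauss_binom n 1) by apply: IH1; lia.
  rewrite /coef_le gauss_binom_pascal !gauss_binom_n0 expr1.
  have -> : 1 + 'X * gauss_binom n 1 - 'X * 1 = 1 + 'X * (gauss_binom n 1 - 1).
    by ring.
  apply: coef_ge0D coef_ge0_1 _; apply: coef_ge0M coef_ge0_X _.
  by rewrite -(gauss_binom_n0 n).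
have : coef_le (gauss_binom n k.+1) (gauss_binom n k.+2) by apply: IH1; lia.
have : coef_le ('X * gauss_binom n k) (gauss_binom n k.+1) by apply: IH2; lia.
rewrite /coef_le (gauss_binom_pascal n k.+1) (gauss_binom_pascal n k).
rewrite (exprS _ k.+1).
set A := gauss_binom n k.+2; set B := gauss_binom n k.+1.
set C := gauss_binom n k; set Y := 'X^_ => h2 h1.
have -> : B + 'X * Y * A - 'X * (C + Y * B) = (B - 'X * C) + 'X * Y * (A - B).
  by ring.
apply: coef_ge0D h2 _; apply: coef_ge0M h1.
by apply: coef_ge0M coef_ge0_X _; apply: coef_ge0_Xn.
Qed.

Lemma gauss_binom_mono_k n j k : (j <= k)%N -> (k.*2 <= n)%N ->
  coef_le (gauss_binom n j) (gauss_binom n k).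
Proof.
move=> lejk; rewrite -(subnKC lejk); elim: (k - j)%N => [|i IHi] le2.
  by rewrite addn0; apply: coef_le_refl.
apply: coef_le_trans (IHi _) _; first lia.
by rewrite addnS; apply: (gauss_binom_rise n).1; lia.
Qed.

(** * Words counted by their number of inversions *)

(** In a word, [true] is the letter B (step +1) and [false] the letter X
    (step -k). *)
Definition nB (w : seq bool) : nat := count id w.
Definition nX (w : seq bool) : nat := count negb w.

(** Inversions.  For the lattice path spelled by the word this is the area that
    the path cuts off from its box, that is, the size of a partition. *)
Fixpoint inv (w : seq bool) : nat :=
  if w is b :: w' then ((if b then nX w' else 0) + inv w')%N else 0%N.

Lemma nB_cat u v : nB (u ++ v) = (nB u + nB v)%N.
Proof. exact: count_cat. Qed.

Lemma nX_cat u v : nX (u ++ v) = (nX u + nX v)%N.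
Proof. exact: count_cat. Qed.

Lemma nBX_size w : (nB w + nX w = size w)%N.
Proof. exact: (count_predC id). Qed.

Lemma inv_cat u v : inv (u ++ v) = (inv u + inv v + nB u * nX v)%N.
Proof.
elim: u => [|b u IHu] /=; first by rewrite addn0.
by rewrite IHu nX_cat /nB /=; case: b; nia.
Qed.

Lemma nB_run k : nB (nseq k true) = k.
Proof. by rewrite /nB count_nseq mul1n. Qed.

Lemma nX_run k : nX (nseq k true) = 0%N.
Proof. by rewrite /nX count_nseq. Qed.

Lemma inv_run k : inv (nseq k true) = 0%N.
Proof. by elim: k => //= k ->; rewrite nX_run. Qed.

Fixpoint words (l p : nat) : seq (seq bool) :=
  if l is l'.+1 then
    map (cons true) (words l' p) ++
    (if p is p'.+1 then map (cons false) (words l' p') else [::])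
  else (if p is 0%N then [:: [::]] else [::]).

Lemma mem_words l p w : (w \in words l p) = (size w == l) && (nX w == p).
Proof.
have mem_cons b c (s : seq (seq bool)) w' :
    (b :: w' \in map (cons c) s) = (b == c) && (w' \in s).
  apply/mapP/andP => [[w'' ? [-> ->]] | [/eqP -> ?]]; first by rewrite eqxx.
  by exists w'.
have mem_nil c (s : seq (seq bool)) : ([::] \in map (cons c) s) = false.
  by apply/mapP => -[].
elim: l p w => [|l IHl] p w.
  by case: p => [|p]; case: w => [|b w]; rewrite ?inE.
rewrite /= mem_cat; case: w => [|b w].
  by rewrite mem_nil; case: p => [|p]; rewrite ?mem_nil.
rewrite mem_cons IHl /nX /= eqSS; case: p => [|p]; rewrite ?mem_cons ?IHl.
  by case: b; rewrite /= ?orbF // andbF.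
by case: b; rewrite /= ?orbF // eqSS.
Qed.

Lemma uniq_words l p : uniq (words l p).
Proof.
have inj_cons b : injective (@cons bool b) by move=> u v [].
elim: l p => [|l IHl] p; first by case: p.
rewrite /= cat_uniq map_inj_uniq // IHl; case: p => //= p.
rewrite map_inj_uniq // IHl andbT.
by apply/hasPn => w /mapP [u _ ->]; apply/mapP => -[].
Qed.

(** Splitting words on their first letter is Pascal's rule: an initial B is in
    an inversion with each of the p letters X, an initial X with none. *)
Lemma gauss_binom_words l p :
  gauss_binom l p = \sum_(w <- words l p) 'X^(inv w).
Proof.
elim: l p => [|l IHl] p.
  case: p => [|p]; first by rewrite gauss_binom_n0 big_seq1.
  by rewrite gauss_binom_small // big_nil.
rewrite /= big_cat /= big_map big_seq_cond.
under eq_bigr => w.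
  rewrite andbT mem_words => /andP [_ /eqP nXw]; rewrite /= nXw exprD.
  over.
rewrite -big_seq_cond -mulr_sumr -IHl.
case: p => [|p]; first by rewrite big_nil addr0 mul1r !gauss_binom_n0.
rewrite big_map gauss_binom_pascal addrC; congr (_ + _).
by rewrite IHl.
Qed.

(** An injection that is only known as a relation is enough: pair off the words
    of s1 one at a time, removing each chosen partner from s2. *)
Lemma sum_match (R : seq bool -> seq bool -> Prop) (s1 s2 : seq (seq bool)) :
  (forall w w' v, R w v -> R w' v -> w = w') -> uniq s1 ->
  (forall w, w \in s1 -> exists v, [/\ R w v, v \in s2 & inv v = inv w]) ->
  coef_le (\sum_(w <- s1) 'X^(inv w)) (\sum_(w <- s2) 'X^(inv w)).
Proof.
move=> injR; elim: s1 s2 => [|w s1 IHs] s2 /=.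
  move=> _ _; rewrite /coef_le big_nil subr0 => i.
  by rewrite coef_sum sumr_ge0 // => v _; apply: coef_ge0_Xn.
case/andP=> w_s1 uniq_s1 exR; have [v [Rwv v_s2 inv_v]] := exR w (mem_head _ _).
rewrite big_cons (perm_big _ (perm_to_rem v_s2)) big_cons /= inv_v.
rewrite /coef_le opprD addrACA subrr add0r.
apply: IHs => // w' w'_s1; have [|v' [Rwv' v'_s2 inv_v']] := exR w'.
  by rewrite inE w'_s1 orbT.
exists v'; split=> //; move: v'_s2; rewrite (perm_mem (perm_to_rem v_s2)) inE.
case/predU1P => // eq_v; rewrite eq_v in Rwv'.
by rewrite (injR _ _ _ Rwv Rwv') w'_s1 in w_s1.
Qed.

(** * Exchanging k letters B for one letter X *)

(** Closed walks that stay above level -k.  The bound is put on the heights of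
    the suffixes: in a closed walk they are opposite to those of the prefixes,
    and suffixes are what a last visit to a level is about. *)
Definition steady (k : nat) (t : seq bool) : Prop :=
  nB t = (k * nX t)%N /\ forall m, (nB (drop m t) < k * nX (drop m t) + k)%N.

(** The shortest suffix whose height is at least j has height exactly j, because
    a step climbs by at most one. *)
Lemma short_suffix {k j w} : (0 < j)%N ->
  (forall m, (nB (drop m w) < k * nX (drop m w) + j)%N) \/
  exists u r, [/\ w = u ++ r, nB r = (k * nX r + j)%N
                & forall m, (nB (drop m.+1 r) < k * nX (drop m.+1 r) + j)%N].
Proof.
move=> j_gt0; elim: w => [|b w [IHw | [u [r [-> nBr suf]]]]].
  by left => m /=; rewrite addn_gt0 j_gt0 orbT.
  have [lt | ge] := ltnP (nB (b :: w)) (k * nX (b :: w) + j)%N.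
    by left=> -[|m] /=.
  right; exists [::], (b :: w); split=> //.
  by have := IHw 0%N; rewrite drop0; move: ge; rewrite /nB /nX /=; case: b; nia.
by right; exists (b :: u), r.
Qed.

(** A walk ending at height at least k splits at its last visit to the level k
    below its end.  It stays above that level afterwards, so it cannot make a
    step of -k before it has climbed by more than k: hence the initial run. *)
Lemma rise_split {k w} : (0 < k)%N -> (k * nX w + k <= nB w)%N ->
  exists u t, w = u ++ nseq k true ++ t /\ steady k t.
Proof.
move=> k_gt0 rise.
have [/(_ 0%N) | [u [r [-> nBr suf]]]] := @short_suffix k k w k_gt0.
  by rewrite drop0 ltnNge rise.
(* The initial run of letters B in r, cut at length k. *)
have [i [t [i_le_k def_r edge]]] :
    exists i t, [/\ (i <= k)%N, r = nseq i true ++ t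
                  & (i < k)%N -> ~~ head false t].
  elim: k {k_gt0 rise nBr suf} r => [|k IHk] r; first by exists 0%N, r.
  case: r => [|[] r]; [by exists 0%N, [::] | | by exists 0%N, (false :: r)].
  have [i [t [le_i -> edge]]] := IHk r.
  by exists i.+1, t; split.
have nBr' : (i + nB t = k * nX t + k)%N.
  by move: nBr; rewrite def_r nB_cat nX_cat nB_run nX_run.
move: i_le_k; rewrite leq_eqVlt => /predU1P [eq_i | lt_i].
  exists u, t; rewrite def_r eq_i; split=> //.
  split; first by move: nBr'; rewrite eq_i; lia.
  move=> m; have := suf (i.-1 + m)%N.
  rewrite def_r drop_cat size_nseq eq_i.
  have -> : ((k.-1 + m).+1 < k)%N = false by lia.
  by have -> : ((k.-1 + m).+1 - k = m)%N by lia.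
case: t edge def_r nBr' => [|b t] edge def_r nBr'.
  by move: nBr'; rewrite /nB /nX /=; lia.
(* A run ended too early by an X leaves a proper suffix that is too high. *)
have := edge lt_i; case: b nBr' def_r {edge} => // nBr' def_r _.
have := suf i; rewrite def_r drop_cat size_nseq.
have -> : (i.+1 < i)%N = false by lia.
rewrite subSnn /= drop0.
by move: nBr'; rewrite /nB /nX /=; nia.
Qed.

(** The X after a steady word is the first step that leads to level -k.  If t
    were shorter than t', then t followed by X would be a prefix of t', and the
    rest of t' a suffix of height k. *)
Lemma steady_cut {k t t' v v'} : steady k t -> steady k t' ->
  t ++ false :: v = t' ++ false :: v' -> t = t' /\ v = v'.
Proof.
have no_shorter s s' x x' : steady k s -> steady k s' ->
    s ++ false :: x = s' ++ false :: x' -> ~ (size s < size s')%N.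
  move=> [nBs _] [nBs' suf] eq_ss lt_ss.
  have [r def_s'] : exists r, s' = s ++ false :: r.
    elim: s s' eq_ss lt_ss {nBs nBs' suf} => [|b s IHs] [|b' s'] //=.
      by move=> [<- _] _; exists s'.
    by move=> [<- eq_ss] lt_ss; have [r ->] := IHs _ eq_ss lt_ss; exists r.
  have := suf (size s).+1; move: nBs'; rewrite def_s' nB_cat nX_cat nBs.
  rewrite -[(size s).+1]add1n -drop_drop drop_size_cat //= drop0.
  by rewrite /nB /nX /=; nia.
move=> st st' eq_tt; have [lt | lt | eq_size] := ltngtP (size t) (size t').
- by case: (no_shorter _ _ _ _ st st' eq_tt).
- by case: (no_shorter _ _ _ _ st' st (esym eq_tt)).
by move/eqP: eq_tt; rewrite eqseq_cat // => /andP [/eqP -> /eqP [->]].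
Qed.

(** The correspondence between walks w from 0 to kd and walks v from 0 to -kd.
    It is a relation since the splitting of w need not be computed; the words w
    that correspond to a given v are what has to be unique. *)
Fixpoint exchange (k d : nat) (w v : seq bool) : Prop :=
  if d is d'.+1 then
    exists u t x, [/\ steady k t, exchange k d' u x,
                      w = u ++ nseq k true ++ t & v = t ++ false :: x]
  else w = v.

Lemma exchange_inj k d w w' v : exchange k d w v -> exchange k d w' v -> w = w'.
Proof.
elim: d w w' v => [|d IHd] w w' v /=; first by move=> -> ->.
move=> [u [t [x [st ex -> ->]]]] [u' [t' [x' [st' ex' ->]]]].
case/(steady_cut st st') => -> eq_x; rewrite -eq_x in ex'.
by rewrite (IHd _ _ _ ex ex').
Qed.

Lemma exchange_stat {k d w v} : nB w = (k * (nX w + d))%N -> exchange k d w v ->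
  [/\ nX v = (nX w + d)%N, nB v = (k * nX w)%N & inv v = inv w].
Proof.
elim: d w v => [|d IHd] w v nBw /=.
  by move=> <-; rewrite addn0 in nBw *.
move=> [u [t [x [[nBt _] ex def_w ->]]]].
have nBu : nB u = (k * (nX u + d))%N.
  by move: nBw; rewrite def_w !nB_cat !nX_cat nB_run nX_run; nia.
have [nXx nBx inv_x] := IHd _ _ nBu ex.
rewrite def_w !inv_cat !nB_cat !nX_cat nB_run nX_run inv_run.
have -> : nX (false :: x) = (nX x).+1 by [].
have -> : nB (false :: x) = nB x by [].
have -> : inv (false :: x) = inv x by [].
by rewrite nXx nBx inv_x nBu nBt; split; nia.
Qed.

Lemma exchange_ex {k d w} : (0 < k)%N -> nB w = (k * (nX w + d))%N ->
  exists v, exchange k d w v.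
Proof.
move=> k_gt0; elim: d w => [|d IHd] w nBw; first by exists w.
have [|u [t [def_w st]]] := @rise_split k w k_gt0; first by nia.
have [|x ex] := IHd u.
  by move: nBw st.1; rewrite def_w !nB_cat !nX_cat nB_run nX_run; nia.
by exists (t ++ false :: x), u, t, x.
Qed.

(** For y = a both sides are equal, and exchange is then the identity; in
    general y - a exchanges are needed to turn a letters X and ky letters B into
    y letters X and ka letters B. *)
Lemma gauss_binom_swap k a y : (0 < k)%N -> (a <= y)%N ->
  coef_le (gauss_binom (a + k * y) a) (gauss_binom (y + k * a) y).
Proof.
move=> k_gt0 leay; rewrite !gauss_binom_words.
apply: (@sum_match (exchange k (y - a))); first exact: exchange_inj.
  exact: uniq_words.
move=> w; rewrite mem_words => /andP [/eqP size_w /eqP nXw].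
have nBw : nB w = (k * (nX w + (y - a)))%N.
  by have := nBX_size w; rewrite size_w nXw subnKC //; lia.
have [v ex] := exchange_ex k_gt0 nBw.
have [nXv nBv inv_v] := exchange_stat nBw ex.
exists v; split=> //; rewrite mem_words -nBX_size nXv nBv nXw subnKC //.
by rewrite addnC !eqxx.
Qed.

Theorem proposition3p2 (a b c d : nat)
    (ha : (0 < a)%N) (hb : (0 < b)%N) (hc : (0 < c)%N) (hd : (0 < d)%N)
    (hmin : a = minn (minn a b) (minn c d))
    (hxy : exists x y : int,
        [/\ x <= y,
            a%:Z <= x <= (minn c d)%:Z,
            x + y <= (c + d)%:Z,
            (a * b)%:Z <= x * y
          & (a%:Z %| x)%Z \/ (a%:Z %| y)%Z]) :
  gauss_binom (c + d) c - gauss_binom (a + b) a \is a polyOver Num.nat.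
Proof.
(* Both integers are positive, so that all the conditions can be read in nat. *)
have {hxy} [x [y [le_xy ax x_cd xy_cd [ab_xy a_dvd]]]] :
    exists x y : nat, [/\ (x <= y)%N, (a <= x)%N, (x <= minn c d)%N,
      (x + y <= c + d)%N & (a * b <= x * y)%N /\ ((a %| x)%N \/ (a %| y)%N)].
  have [x [y [le_xy /andP [ax xcd] xycd abxy dvd]]] := hxy.
  have [x' def_x] : exists x' : nat, x = x'%:Z by exists `|x|%N; lia.
  have [y' def_y] : exists y' : nat, y = y'%:Z by exists `|y|%N; lia.
  rewrite {}def_x {}def_y in le_xy ax xcd xycd abxy dvd.
  by exists x', y'; split; [lia | lia | lia | lia | split; [lia | exact: dvd]].
have a_le_y : (a <= y)%N by exact: leq_trans ax le_xy.
apply: coef_ge0_polyOver.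
apply: (@coef_le_trans (gauss_binom (x + y) x)).
  case: a_dvd => /dvdnP [k def_k].
    have k_gt0 : (0 < k)%N by case: k def_k => [|k] //; lia.
    apply: (@coef_le_trans (gauss_binom (a + k * y) a)).
      apply: gauss_binom_mono_n; rewrite leq_add2l -(leq_pmul2l ha).
      by move: ab_xy; rewrite def_k; nia.
    by rewrite (gauss_binom_sym x) (addnC x) def_k; apply: gauss_binom_swap.
  have k_gt0 : (0 < k)%N by case: k def_k => [|k] //; lia.
  apply: (@coef_le_trans (gauss_binom (a + k * x) a)).
    apply: gauss_binom_mono_n; rewrite leq_add2l -(leq_pmul2l ha).
    by move: ab_xy; rewrite def_k; nia.
  by rewrite def_k; apply: gauss_binom_swap.
apply: coef_le_trans (gauss_binom_mono_n _ _ _ xy_cd) _.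
have -> : gauss_binom (c + d) c = gauss_binom (c + d) (minn c d).
  by rewrite /minn; case: ifP => // _; apply: gauss_binom_sym.
by apply: gauss_binom_mono_k => //; lia.
Qed.
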